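(* Let $G$ be a loopless graph and let $v$ be a vertex of $G$ of degree $n\ge 1$ such that the set $\mathrm{lk}(v)=\{v_1,\dots,v_n\}$ is an independent set. Write $W_i=\mathrm{lk}(v_i)\setminus\{v\}$ for $1\le i\le n$, and define $\mathcal{K}(G,v)$ as the complex obtained from $I_{G-\mathrm{st}(v)}$ by deleting all simplices $s$ of $I_{G-\mathrm{st}(v)}$ such that $s\cap W_i\neq\emptyset$ for every $i\in\{1,\dots,n\}$. Then $I_G$ is homotopy equivalent to the suspension of $\mathcal{K}(G,v)$.
   Context: Graphs are finite. For a vertex $u$ of a graph $G$, $\mathrm{lk}(u)$ is the set of vertices adjacent to $u$ and $\mathrm{st}(u)=\mathrm{lk}(u)\cup\{u\}$; for a set $A$ of vertices, $G-A$ is the induced subgraph on the remaining vertices. The independence complex $I_G$ of a loopless graph $G$ is the simplicial complex whose simplices are the independent sets of vertices of $G$ (the empty set is always included as a simplex of dimension $-1$); it is identified with its geometric realization. The complex $\{\emptyset\}$ is denoted $S^{-1}$. The suspension $\Sigma\mathcal{K}$ of a complex $\mathcal{K}$ is its join with two isolated points $S^0$; in particular $\Sigma S^{-1}=S^0$. *)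

(* Defs.v *)
From mathcomp Require Import all_boot all_order all_algebra.
From mathcomp Require Import all_classical all_reals topology normedtype.

Set Implicit Arguments.
Unset Strict Implicit.
Unset Printing Implicit Defensive.

Import Order.TTheory GRing.Theory Num.Theory numFieldNormedType.Exports.

Local Open Scope classical_set_scope.
Local Open Scope ring_scope.

Section Homotopy.
Variables (R : realType) (X Y : topologicalType).

Definition homotopic (f g : X -> Y) : Prop :=
  exists H : X * R -> Y,
    [/\ {within [set: X] `*` `[0, 1], continuous H},
        forall x, H (x, 0) = f x &
        forall x, H (x, 1) = g x].

End Homotopy.

Definition homotopy_equivalent (R : realType) (X Y : topologicalType) : Prop :=
  exists (f : X -> Y) (g : Y -> X),
    [/\ continuous f, continuous g,
        homotopic R (g \o f) id & homotopic R (f \o g) id].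

(* A complex on the vertex type V is the set of its simplices, the empty
   simplex included; elements of V that lie in no simplex are allowed. *)
Section Complexes.
Variables V W : finType.

Definition is_complex (K : {set {set V}}) : Prop :=
  finset.set0 \in K /\
  forall s t : {set V}, t \subset s -> s \in K -> t \in K.

(* Barycentric coordinates; empty for the complex [set set0], i.e. S^{-1}. *)
Definition realization_points (R : realType) (K : {set {set V}}) :
    set {ptws V -> R} :=
  [set x | [/\ forall u, 0 <= x u, \sum_u x u = 1 &
               [set u | x u != 0]%SET \in K]].

Definition realization (R : realType) (K : {set {set V}}) : topologicalType :=
  set_type (@realization_points R K).

Definition join (K : {set {set V}}) (L : {set {set W}}) :
    {set {set V + W}} :=
  [set s : {set V + W} | (inl @^-1: s \in K) && (inr @^-1: s \in L)]%SET.

End Complexes.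

Arguments realization_points {V} R K _.
Arguments realization {V} R K.

(* Two isolated points. *)
Definition S0 : {set {set bool}} := [set s : {set bool} | (#|s| <= 1)%N]%SET.

Definition suspension (V : finType) (K : {set {set V}}) :
    {set {set V + bool}} :=
  join K S0.

(* A loopless graph is a symmetric irreflexive adjacency relation e on V. *)
Section Graphs.
Variables (V : finType) (e : rel V).

Definition lk (u : V) : {set V} := [set w | e u w]%SET.

Definition st (u : V) : {set V} := (u |: lk u)%SET.

Definition degree (u : V) : nat := #|lk u|.

Definition independent (s : {set V}) : bool :=
  [forall x in s, forall y in s, ~~ e x y].

(* The independence complex of the subgraph of e induced on A, whose simplices
   are the independent sets of e contained in A. *)
Definition induced_independence_complex (A : {set V}) : {set {set V}} :=
  [set s : {set V} | (s \subset A) && independent s]%SET.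

Definition independence_complex : {set {set V}} :=
  induced_independence_complex [set: V]%SET.

(* The set W_i attached to the neighbour u = v_i of v is lk u :\ v. *)
Definition complexK (v : V) : {set {set V}} :=
  (induced_independence_complex (~: st v) :\:
   [set s : {set V} |
     [forall u in lk v, s :&: (lk u :\ v) != finset.set0]])%SET.

End Graphs.

Lemma S0_is_complex : is_complex S0.
Proof.
split=> [|s t ts]; rewrite !inE ?cards0 //.
exact: leq_trans (subset_leq_card ts).
Qed.

Lemma join_is_complex (V W : finType) (K : {set {set V}}) (L : {set {set W}}) :
  is_complex K -> is_complex L -> is_complex (join K L).
Proof.
move=> [K0 Ks] [L0 Ls]; split=> [|s t ts].
  by rewrite inE !preimset0 K0 L0.
rewrite !inE => /andP[sK sL]; apply/andP; split.
  by apply: Ks sK; apply: preimsetS.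
by apply: Ls sL; apply: preimsetS.
Qed.

Lemma induced_independence_is_complex (V : finType) (e : rel V) (A : {set V}) :
  is_complex (induced_independence_complex e A).
Proof.
split=> [|s t ts]; rewrite !inE.
  by rewrite finset.sub0set; apply/forall_inP => x; rewrite inE.
move=> /andP[sA /forall_inP si]; rewrite (fintype.subset_trans ts sA) /=.
apply/forall_inP => x xt; apply/forall_inP => y yt.
by move/forall_inP: (si x (fintype.subsetP ts x xt)); apply;
  exact: (fintype.subsetP ts).
Qed.

Lemma complexK_is_complex (V : finType) (e : rel V) (v : V) :
  (0 < degree e v)%N -> is_complex (complexK e v).
Proof.
move=> /card_gt0P[u uv].
have [I0 Isub] := induced_independence_is_complex e (~: st e v)%SET.
split=> [|s t ts].
  rewrite finset.in_setD I0 andbT inE; apply/forall_inPn; exists u => //.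
  by rewrite finset.set0I eqxx.
rewrite !finset.in_setD => /andP[sN /(Isub _ _ ts) ->]; rewrite andbT.
apply: contra sN; rewrite !inE => /forall_inP tN.
apply/forall_inP => w /tN /finset.set0Pn[x]; rewrite finset.in_setI => /andP[xt xw].
by apply/finset.set0Pn; exists x; rewrite finset.in_setI (fintype.subsetP ts).
Qed.

(* Main.v *)
Require Import Defs.
From mathcomp Require Import all_boot all_order all_algebra.
From mathcomp Require Import all_classical all_reals topology normedtype.
From mathcomp Require Import ring lra.

Set Implicit Arguments.
Unset Strict Implicit.
Unset Printing Implicit Defensive.

Import Order.TTheory GRing.Theory Num.Theory numFieldNormedType.Exports.

Local Open Scope classical_set_scope.
Local Open Scope ring_scope.

(** Call the elements of B := V \ st(v) outer vertices.  A simplex of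
    I_G is either v with an independent set of outer vertices, or t together
    with s, where t is a subset of lk(v) and s is an independent set of outer
    vertices not adjacent to t; if t is nonempty then s lies in K(G,v).  So I_G
    is the union of the cone with apex v over the independent sets of outer
    vertices and of the subcomplex generated by the simplices that meet lk(v).
    The second part deforms onto the full simplex on lk(v), so both parts are
    contractible, and they meet exactly in K(G,v); this is why I_G looks like a
    suspension.  Instead of gluing, the proof gives explicit formulas in
    barycentric coordinates, each followed by division by the sum of the
    coordinates (normalized_map).  N and S are the two suspension points, inr true
    and inr false.

    For a in lk(v) let load x a be the sum of x over the outer neighbours of a,
    and let m = min_load x be the least load.  The support of x in B is a
    simplex of K(G,v) exactly when m = 0.

    - collapse : I_G -> Sigma K(G,v) lowers the outer coordinates by m, cut off
      at 0, and moves what was removed, as well as x_v, to N; the mass of lk(v)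
      goes to S.  A neighbour of v of load m then loses all its outer
      neighbours, so that the remaining support is in K(G,v).
    - spread : Sigma K(G,v) -> I_G sends N to v, lowers the outer coordinates by
      y_S, and gives a in lk(v) the weight y_S - load y a, both cut off at 0.
      If a gets weight then all its outer neighbours have coordinate below y_S
      and are lost.  This makes the support independent, and lets the weights
      on lk(v) vary continuously near S, where in general no choice of
      neighbours compatible with the whole support does.

    Two maps whose supports at each point lie in a common simplex are joined by
    a straight-line homotopy.  The support of collapse (spread y) is contained
    in that of y, which settles one composite.  For the other composite the
    supports of x and spread (collapse x) need not lie in a common simplex,
    but both can be joined to an intermediate map, trim, which lowers the outer
    coordinates by the mass s of lk(v).  The point trim x is supported in the
    support of x, and the vertices in the supports of trim x and
    spread (collapse x) all belong to one independent set, described by comparing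
    coordinates with s (admissible_independent, which also shows that spread is
    well defined).  Hence a homotopy along broken lines with two segments
    (homotopic_broken_line). *)

(** * Maps and homotopies between geometric realizations *)

Section Realizations.
Variables (R : realType) (V : finType).
Implicit Types (K : {set {set V}}) (T : topologicalType).

Definition support (x : V -> R) : {set V} := [set u | x u != 0]%SET.

Definition coord K (x : realization R K) : V -> R := \val x.

Lemma coordP K (x : realization R K) :
  [/\ forall u, 0 <= coord x u, \sum_u coord x u = 1 & support (coord x) \in K].
Proof. exact: set_valP x. Qed.

Lemma coord_ge0 K (x : realization R K) u : 0 <= coord x u.
Proof. by case: (coordP x). Qed.

Lemma coord_sum K (x : realization R K) : \sum_u coord x u = 1.
Proof. by case: (coordP x). Qed.

Lemma coord_support K (x : realization R K) : support (coord x) \in K.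
Proof. by case: (coordP x). Qed.

Lemma coord_continuous K u : continuous (fun x : realization R K => coord x u).
Proof.
move=> x; apply: (@continuous_comp (realization R K) {ptws V -> R} R
  set_val (@proj V (fun=> R) u)).
  exact: initial_continuous.
exact: proj_continuous.
Qed.

Lemma sum1_exists_gt0 (x : V -> R) :
  (forall u, 0 <= x u) -> \sum_u x u = 1 -> exists u, 0 < x u.
Proof.
move=> x_ge0 x_sum; have : \sum_u x u != 0 by rewrite x_sum oner_eq0.
by rewrite psumr_neq0// => /hasP[u _ xu]; exists u.
Qed.

Lemma coord_gt0 K (x : realization R K) : exists u, 0 < coord x u.
Proof. by apply: sum1_exists_gt0; [exact: coord_ge0|exact: coord_sum]. Qed.

Lemma support_gt0 (x : V -> R) u :
  (forall u', 0 <= x u') -> (u \in support x) = (0 < x u).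
Proof. by move=> x_ge0; rewrite inE lt_def x_ge0 andbT. Qed.

(** Continuous nonnegative weights, not all zero, become barycentric coordinates
    after division by their sum.  Only a positive factor c, the inverse of
    that sum, separates the two, so comparisons between weights carry over. *)
Lemma normalized_map T K (w : T -> V -> R) :
  (forall u, continuous (w^~ u)) -> (forall t u, 0 <= w t u) ->
  (forall t, exists u, 0 < w t u) -> (forall t, support (w t) \in K) ->
  exists f : T -> realization R K, continuous f /\
    forall t, exists2 c, 0 < c & forall u, coord (f t) u = c * w t u.
Proof.
move=> w_cont w_ge0 w_gt0 wK.
have sum_gt0 t : 0 < \sum_u w t u.
  have [u wu] := w_gt0 t; rewrite (bigD1 u)//=.
  by apply: ltr_pwDl => //; apply: sumr_ge0 => *; exact: w_ge0.
pose p t : {ptws V -> R} := fun u => w t u / \sum_u' w t u'.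
have pK t : p t \in @realization_points V R K.
  apply/mem_set; split=> [u||].
  - by rewrite divr_ge0// ltW.
  - by rewrite /p -mulr_suml divff// gt_eqF.
  - suff -> : [set u | p t u != 0]%SET = support (w t) by [].
    apply/setP => u; rewrite !inE /p mulf_eq0 invr_eq0.
    by rewrite [_ == 0 :> R in X in _ || X]gt_eqF// orbF.
exists (fun t => exist _ (p t) (pK t) : realization R K); split; last first.
  move=> t; exists (\sum_u w t u)^-1; first by rewrite invr_gt0.
  by move=> u; rewrite mulrC.
apply: continuous_comp_initial => t; apply/cvg_sup => u.
move=> U [_ [[W oW <-]]] Wtu WU; apply: (filterS WU) => /=.
have p_cont : {for t, continuous (fun t => p t u)}.
  apply: cvgM; first exact: w_cont.
  apply: cvgV; first by rewrite gt_eqF.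
  apply: (@cvg_big _ _ +%R 0 xpredT) => // [|i _]; last exact: w_cont.
  exact: add_continuous.
by apply: p_cont; exact: open_nbhs_nbhs.
Qed.

(** The path from f t to g t runs along the segment to h t and then along the one
    from h t.  At each time only two of the three points carry weight, so each
    support condition concerns two consecutive points, and no concatenation of
    homotopies is needed. *)
Lemma homotopic_broken_line T K (f h g : T -> realization R K) :
  is_complex K -> continuous f -> continuous h -> continuous g ->
  (forall t, support (coord (f t)) :|: support (coord (h t)) \in K)%SET ->
  (forall t, support (coord (h t)) :|: support (coord (g t)) \in K)%SET ->
  homotopic R f g.
Proof.
move=> [_ K_sub] f_cont h_cont g_cont fhK hgK.
pose clamp (r : R) := Num.max 0 (Num.min 1 r).
(* The weights of f, h and g at time r are a r, 1 - a r - c r and c r: the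
   weight of f falls to 0 at time 1/2, and that of g rises from 0 after it.
   Clamping makes them meaningful for every real r. *)
pose a r : R := clamp (1 - 2 * r).
pose c r : R := clamp (2 * r - 1).
pose w (p : T * R) u := a p.2 * coord (f p.1) u +
  (1 - a p.2 - c p.2) * coord (h p.1) u + c p.2 * coord (g p.1) u.
have clamp_ge0 r : 0 <= clamp r by rewrite le_max lexx.
have ac r : a r = 0 /\ c r <= 1 \/ c r = 0 /\ a r <= 1.
  rewrite /a /c /clamp; case: (leP 1 (2 * r)) => r1; [left|right].
    by split; [apply/max_idPl; rewrite ge_min; apply/orP; right; lra|
               rewrite ge_max ge_min lexx ler01].
  by split; [apply/max_idPl; rewrite ge_min; apply/orP; right; lra|
             rewrite ge_max ge_min lexx ler01].
have b_ge0 r : 0 <= 1 - a r - c r by case: (ac r) => -[-> ?]; lra.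
have w_ge0 p u : 0 <= w p u.
  by rewrite /w !addr_ge0// mulr_ge0 ?coord_ge0 ?clamp_ge0.
have w_sum p : \sum_u w p u = 1.
  by rewrite !big_split/= -!mulr_sumr !coord_sum; lra.
have clamp_cont (k : T * R -> R) : continuous k -> continuous (clamp \o k).
  move=> k_cont p.
  apply: (@continuous_max R _ (fun=> 0) (fun p => Num.min 1 (k p)) p).
    exact: cvg_cst.
  apply: (@continuous_min R _ (fun=> 1) k p); first exact: cvg_cst.
  exact: k_cont.
have a_cont : continuous (fun p : T * R => a p.2).
  apply: (clamp_cont (fun p => 1 - 2 * p.2)) => p.
  by apply: cvgB; [exact: cvg_cst|apply: cvgM; [exact: cvg_cst|exact: cvg_snd]].
have c_cont : continuous (fun p : T * R => c p.2).
  apply: (clamp_cont (fun p => 2 * p.2 - 1)) => p.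
  by apply: cvgB; [apply: cvgM; [exact: cvg_cst|exact: cvg_snd]|exact: cvg_cst].
have fst_cont (k : T -> realization R K) u :
    continuous k -> continuous (fun p : T * R => coord (k p.1) u).
  move=> k_cont p.
  apply: (@continuous_comp _ _ _ (fun p : T * R => p.1) (fun t => coord (k t) u)).
    exact: cvg_fst.
  apply: (@continuous_comp _ _ _ k (fun y => coord y u)); first exact: k_cont.
  exact: coord_continuous.
have w_cont u : continuous (w^~ u).
  move=> p; apply: cvgD; first apply: cvgD.
  - by apply: cvgM; [exact: a_cont|exact: fst_cont].
  - apply: cvgM; last exact: fst_cont.
    by apply: cvgB; [apply: cvgB; [exact: cvg_cst|exact: a_cont]|exact: c_cont].
  - by apply: cvgM; [exact: c_cont|exact: fst_cont].
have w_gt0 p : exists u, 0 < w p u by exact: sum1_exists_gt0.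
have wK p : support (w p) \in K.
  case: (ac p.2) => -[ac0 _]; [apply: K_sub (hgK p.1)|apply: K_sub (fhK p.1)];
  apply/fintype.subsetP => u; rewrite !inE; apply: contraR;
  by rewrite negb_or !negbK /w ac0 => /andP[/eqP-> /eqP->]; apply/eqP; ring.
have [H [H_cont HE]] := normalized_map w_cont w_ge0 w_gt0 wK.
have {}HE p u : coord (H p) u = w p u.
  have [r _ Hr] := HE p; rewrite Hr.
  suff -> : r = 1 by rewrite mul1r.
  by rewrite -(coord_sum (H p)) (eq_bigr _ (fun u _ => Hr u)) -mulr_sumr w_sum mulr1.
have coord_inj (x y : realization R K) : coord x =1 coord y -> x = y.
  by move=> xy; apply: val_inj; apply/funext.
have clamp1 : clamp 1 = 1 by rewrite /clamp minxx (max_idPr ler01).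
have clampN1 : clamp (-1) = 0.
  by apply/max_idPl; rewrite ge_min lerN10 orbT.
have a0 : a 0 = 1 by rewrite /a mulr0 subr0.
have c0 : c 0 = 0 by rewrite /c mulr0 sub0r.
have a1 : a 1 = 0 by rewrite /a mulr1 (_ : 1 - 2 = -1 :> R)//; lra.
have c1 : c 1 = 1 by rewrite /c mulr1 (_ : 2 - 1 = 1 :> R)//; lra.
exists H; split; first exact: continuous_subspaceT.
- move=> x; apply: coord_inj => u; rewrite HE /w /= a0 c0.
  by rewrite mul1r subrr subr0 !mul0r !addr0.
- move=> x; apply: coord_inj => u; rewrite HE /w /= a1 c1.
  by rewrite mul1r subr0 subrr !mul0r !add0r.
Qed.

End Realizations.

(** * Simplices of the complexes involved *)

Section Complexes.
Variables (V : finType) (e : rel V).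

Lemma in_independence_complex (s : {set V}) :
  (s \in independence_complex e) = independent e s.
Proof. by rewrite !inE finset.subsetT. Qed.

Lemma independentP (s : {set V}) :
  reflect {in s &, forall x y, ~~ e x y} (independent e s).
Proof.
apply: (iffP forall_inP) => [ind x y xs|ind x xs].
  by move/forall_inP: (ind x xs); apply.
by apply/forall_inP => y; exact: ind.
Qed.

Lemma independentS (s t : {set V}) :
  t \subset s -> independent e s -> independent e t.
Proof.
move=> /fintype.subsetP ts /independentP ind; apply/independentP => x y xt yt.
by apply: ind; exact: ts.
Qed.

Lemma in_st v u : (u \in st e v) = (u == v) || (u \in lk e v).
Proof. by rewrite !inE. Qed.

(** A simplex of K(G,v) misses the neighbourhood of some neighbour of v.  Here
    the set W_i of the i-th neighbour is replaced by the whole neighbourhood,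
    which meets the simplex in the same set because v is not in the simplex. *)
Lemma complexKP v (s : {set V}) :
  reflect [/\ s \subset ~: st e v, independent e s &
    exists2 a, a \in lk e v & forall b, b \in s -> ~~ e a b]%SET
  (s \in complexK e v).
Proof.
rewrite finset.in_setD [in X in _ && X]inE andbC -andbA.
apply: (iffP and3P) => [[sB ind notN]|[sB ind [a av ha]]]; split=> //.
  move: notN; rewrite inE => /forall_inPn[a av /negPn/eqP sa]; exists a => // b bs.
  apply/negP => ab; suff: b \in finset.set0 by rewrite inE.
  rewrite -sa !inE bs ab !andbT; apply: contraTneq (fintype.subsetP sB b bs).
  by move=> ->; rewrite finset.in_setC in_st eqxx.
rewrite inE; apply/forall_inPn; exists a => //; apply/negPn/eqP/setP => b.
rewrite !inE; apply/negP => /and3P[bs _ ab].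
by have := ha b bs; rewrite ab.
Qed.

Lemma in_suspension (K : {set {set V}}) (s : {set V + bool}) :
  (s \in suspension K) =
  (inl @^-1: s \in K)%SET && ((inr true \notin s) || (inr false \notin s)).
Proof.
rewrite inE; congr (_ && _); rewrite inE.
apply/idP/orP => [s1|s01].
  apply/orP; rewrite -negb_and; apply: contraTN s1 => /andP[st sf].
  rewrite -ltnNge -[2%N]card_bool; apply: subset_leq_card.
  by apply/fintype.subsetP => -[] _; rewrite inE.
have [b sb] : exists b, inr b \notin s.
  by case: s01; [exists true|exists false].
rewrite -(cards1 (~~ b)); apply: subset_leq_card; apply/fintype.subsetP => c.
by rewrite !inE; apply: contraTT => cb; have -> : c = b by case: b c cb {sb} => -[].
Qed.

End Complexes.

(** * Thresholds on the coordinates around a vertex *)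

Section Maps.
Variables (R : realType) (V : finType) (e : rel V) (v : V).
Implicit Types (x : V -> R) (y : V + bool -> R) (a b u : V) (q : V + bool).
Hypotheses (e_sym : symmetric e) (e_irr : irreflexive e).
Hypothesis lk_indep : independent e (lk e v).

Local Notation B := (~: st e v)%SET.

Lemma vertex_cases u : [\/ u = v, u \in lk e v | u \in B].
Proof.
rewrite finset.in_setC in_st; case: eqP => [->|_]; first by constructor 1.
by case: (boolP (u \in lk e v)) => ?; [constructor 2|constructor 3].
Qed.

Lemma outside_neq b : b \in B -> b != v.
Proof. by rewrite finset.in_setC in_st negb_or => /andP[]. Qed.

Lemma outside_notin_lk b : b \in B -> b \notin lk e v.
Proof. by rewrite finset.in_setC in_st negb_or => /andP[]. Qed.

(** The mass that x places on W_a.  The outer neighbours of a form W_a, since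
    lk(v) is independent. *)
Definition load (x : V -> R) (a : V) : R := \sum_(b in B | e a b) x b.

Lemma load_ge0 x a : (forall u, 0 <= x u) -> 0 <= load x a.
Proof. by move=> x_ge0; apply: sumr_ge0. Qed.

Lemma le_load x a b : (forall u, 0 <= x u) -> b \in B -> e a b -> x b <= load x a.
Proof.
move=> x_ge0 bB ab; rewrite /load (bigD1 b) ?bB//= lerDl.
exact: sumr_ge0.
Qed.

Lemma load_eq0 x a : (forall b, b \in B -> e a b -> x b = 0) -> load x a = 0.
Proof. by move=> x0; apply: big1 => b /andP[]; exact: x0. Qed.

Lemma load_continuous (T : topologicalType) (x : T -> V -> R) a :
  (forall u, continuous (x^~ u)) -> continuous (fun t => load (x t) a).
Proof.
move=> x_cont; apply: (continuous_big (op := +%R)) => [|b _]; last exact: x_cont.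
exact: add_continuous.
Qed.

(** The vertices that can carry weight when outer vertices are kept only above the
    level s, and a neighbour of v only if its outer neighbours are at most s.
    The vertex v is adjacent to all of lk(v), so it is tied to the level s = 0
    at which lk(v) carries nothing. *)
Definition admissible (x : V -> R) (s : R) (u : V) : Prop :=
  [\/ u = v /\ s = 0,
      [/\ u \in lk e v, 0 < s & forall b, b \in B -> e u b -> x b <= s] |
      u \in B /\ s < x u].

(** An edge between lk(v) and B would need an outer coordinate both above and at
    most s, and an edge at v would need s to be both zero and positive. *)
Lemma admissible_independent x s (t : {set V}) :
  independent e [set u in B | s < x u]%SET ->
  (forall u, u \in t -> admissible x s u) -> independent e t.
Proof.
move=> /independentP ind t_adm; apply/independentP => p q /t_adm + /t_adm.
have v_out b : b \in B -> e v b = false.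
  by move=> /outside_notin_lk; rewrite inE => /negPf.
case=> [[-> s0]|[pv s_gt0 p_le]|[pB xp]]
  [[-> s0']|[qv s_gt0' q_le]|[qB xq]].
- by rewrite e_irr.
- by rewrite s0 ltxx in s_gt0'.
- by rewrite v_out.
- by rewrite s0' ltxx in s_gt0.
- exact: (independentP _ _ lk_indep).
- by apply/negP => /(p_le q qB); rewrite leNgt xq.
- by rewrite e_sym v_out.
- by rewrite e_sym; apply/negP => /(q_le p pB); rewrite leNgt xp.
- by apply: ind; rewrite inE; apply/andP.
Qed.

Variable a0 : V.
Hypothesis a0_lk : a0 \in lk e v.

(** The minimum is over a nonempty set; the known member a0 of lk(v) supplies the
    initial value, so that the minimum is always attained. *)
Definition min_load (x : V -> R) : R :=
  \big[Num.min/load x a0]_(a in lk e v) load x a.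

Lemma min_load_eq x : exists2 a, a \in lk e v & min_load x = load x a.
Proof.
rewrite /min_load; elim/big_ind: _ => [|r1 r2 [a av ->] [b bv ->]|a av].
- by exists a0.
- by case: leP => _; [exists a|exists b].
- by exists a.
Qed.

Lemma min_load_le x a : a \in lk e v -> min_load x <= load x a.
Proof. by move=> av; rewrite /min_load (bigD1 a)//= ge_min lexx. Qed.

Lemma min_load_ge0 x : (forall u, 0 <= x u) -> 0 <= min_load x.
Proof. by move=> x_ge0; have [a _ ->] := min_load_eq x; exact: load_ge0. Qed.

Lemma min_load_continuous (T : topologicalType) (x : T -> V -> R) :
  (forall u, continuous (x^~ u)) -> continuous (fun t => min_load (x t)).
Proof.
move=> x_cont; rewrite /min_load; elim: (index_enum V) => [|a r IHr] t.
  under eq_fun do rewrite big_nil; exact: load_continuous.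
under eq_fun do rewrite big_cons; case: ifP => _; last exact: IHr.
apply: (@continuous_min R T (fun t => load (x t) a) _ t); last exact: IHr.
exact: load_continuous.
Qed.

(** * The maps between the independence complex and the suspension *)

Definition lk_mass (x : V -> R) : R := \sum_(a in lk e v) x a.

Lemma lk_mass_ge0 x : (forall u, 0 <= x u) -> 0 <= lk_mass x.
Proof. by move=> x_ge0; exact: sumr_ge0. Qed.

Lemma le_lk_mass x a : (forall u, 0 <= x u) -> a \in lk e v -> x a <= lk_mass x.
Proof.
by move=> x_ge0 av; rewrite /lk_mass (bigD1 a)//= lerDl; exact: sumr_ge0.
Qed.

Lemma lk_mass_gt0 x : (forall u, 0 <= x u) -> 0 < lk_mass x ->
  exists2 a, a \in lk e v & 0 < x a.
Proof.
move=> x_ge0; rewrite lt_def psumr_neq0// => /andP[/hasP[a _ /andP[av xa]] _].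
by exists a.
Qed.

Lemma lk_mass_continuous (T : topologicalType) (x : T -> V -> R) :
  (forall u, continuous (x^~ u)) -> continuous (fun t => lk_mass (x t)).
Proof.
move=> x_cont; apply: (continuous_big (op := +%R)) => [|a _]; last exact: x_cont.
exact: add_continuous.
Qed.

Definition collapse (x : V -> R) (q : V + bool) : R :=
  match q with
  | inl b => if b \in B then Num.max 0 (x b - min_load x) else 0
  | inr true => x v + \sum_(b in B) Num.min (x b) (min_load x)
  | inr false => lk_mass x
  end.

Definition spread (y : V + bool -> R) (u : V) : R :=
  if u == v then y (inr true)
  else if u \in lk e v then Num.max 0 (y (inr false) - load (y \o inl) u)
  else Num.max 0 (y (inl u) - y (inr false)).

Definition trim (x : V -> R) (u : V) : R :=
  if u \in B then Num.max 0 (x u - lk_mass x) else x u.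

Lemma subtract_gt0 (r s : R) : (0 < Num.max 0 (r - s)) = (s < r).
Proof. by rewrite lt_max ltxx subr_gt0. Qed.

Lemma collapse_ge0 x q : (forall u, 0 <= x u) -> 0 <= collapse x q.
Proof.
move=> x_ge0; case: q => [b|[]] /=.
- by case: ifP; rewrite // le_max lexx.
- rewrite addr_ge0// sumr_ge0// => b _.
  by rewrite le_min x_ge0 min_load_ge0.
- exact: lk_mass_ge0.
Qed.

(** No mass is lost: what an outer coordinate keeps above the minimal load and what
    it passes to the pole inr true add up to it. *)
Lemma collapse_gt0 x : (forall u, 0 <= x u) -> (exists u, 0 < x u) ->
  exists q, 0 < collapse x q.
Proof.
move=> x_ge0 [u xu].
have min_ge0 b : 0 <= Num.min (x b) (min_load x).
  by rewrite le_min x_ge0 min_load_ge0.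
have [uv|uv|uB] := vertex_cases u.
- by exists (inr true); rewrite /= -uv ltr_pwDl// sumr_ge0.
- exists (inr false) => /=; exact: lt_le_trans xu (le_lk_mass _ uv).
- have [xm|mx] := leP (x u) (min_load x).
    exists (inr true); rewrite /= (bigD1 u)//= (min_idPl xm) addrCA.
    by rewrite ltr_pwDl// addr_ge0// sumr_ge0.
  by exists (inl u); rewrite /= uB subtract_gt0.
Qed.

Lemma max_continuous (T : topologicalType) (f g : T -> R) :
  continuous f -> continuous g -> continuous (fun t => Num.max (f t) (g t)).
Proof.
by move=> f_cont g_cont t; apply: (@continuous_max R T f g t);
  [exact: f_cont|exact: g_cont].
Qed.

Lemma subtract_continuous (T : topologicalType) (f g : T -> R) :
  continuous f -> continuous g -> continuous (fun t => Num.max 0 (f t - g t)).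
Proof.
move=> f_cont g_cont; apply: max_continuous => [|t]; first exact: cst_continuous.
by apply: cvgB; [exact: f_cont|exact: g_cont].
Qed.

Lemma collapse_continuous (T : topologicalType) (x : T -> V -> R) q :
  (forall u, continuous (x^~ u)) -> continuous (fun t => collapse (x t) q).
Proof.
move=> x_cont; have m_cont := min_load_continuous x_cont.
case: q => [b|[]] /=.
- case: (b \in B); last exact: cst_continuous.
  exact: subtract_continuous.
- move=> t; apply: cvgD; first exact: x_cont.
  apply: (@continuous_big _ _ +%R 0 (mem B) _ _ _
    (fun b t => Num.min (x t b) (min_load (x t)))).
    exact: add_continuous.
  move=> b _ {}t.
  by apply: (@continuous_min R T (x^~ b) (fun t => min_load (x t)) t);
    [exact: x_cont|exact: m_cont].
- exact: lk_mass_continuous.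
Qed.

(** If some a in lk(v) carries weight, independence of the support kills the
    coordinates of all neighbours of a, v among them, and so the load of a. *)
Lemma lk_mass_gt0_vanish x : (forall u, 0 <= x u) -> independent e (support x) ->
  0 < lk_mass x -> x v = 0 /\ min_load x = 0.
Proof.
move=> x_ge0 /independentP x_ind /(lk_mass_gt0 x_ge0)[a av xa].
have x0 u : e a u -> x u = 0.
  move=> au; apply/eqP; rewrite eq_le x_ge0 andbT leNgt; apply/negP => xu.
  by have := x_ind a u; rewrite !support_gt0// xa xu au => /(_ isT isT).
split; first by apply: x0; rewrite e_sym; rewrite inE in av.
apply/eqP; rewrite eq_le min_load_ge0// andbT.
by rewrite (le_trans (min_load_le x av))// load_eq0// => b _; exact: x0.
Qed.

(** The neighbour of v realizing the minimal load witnesses that the truncated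
    support is in K(G,v); the two poles exclude each other because mass on lk(v)
    forces x v and the minimal load to vanish. *)
Lemma collapse_support x : (forall u, 0 <= x u) -> independent e (support x) ->
  support (collapse x) \in suspension (complexK e v).
Proof.
move=> x_ge0 x_ind.
have c_ge0 q : 0 <= collapse x q by exact: collapse_ge0.
have supp_b b : b \in (inl @^-1: support (collapse x))%SET ->
    b \in B /\ min_load x < x b.
  rewrite inE support_gt0//=; case: ifP => bB; last by rewrite ltxx.
  by rewrite subtract_gt0.
rewrite in_suspension; apply/andP; split.
  apply/complexKP; split.
  - by apply/fintype.subsetP => b /supp_b[].
  - apply: independentS x_ind; apply/fintype.subsetP => b /supp_b[_ xb].
    by rewrite support_gt0// (le_lt_trans _ xb)// min_load_ge0.
  - have [a av ma] := min_load_eq x; exists a => // b /supp_b[bB xb].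
    by apply: contraTN xb => ab; rewrite -leNgt ma le_load.
rewrite -negb_and; apply/negP; rewrite !support_gt0//= => /andP[+ s_gt0].
have [-> ->] := lk_mass_gt0_vanish x_ge0 x_ind s_gt0.
rewrite add0r big1 ?ltxx// => b _.
by apply/min_idPr.
Qed.

Lemma spread_v y : spread y v = y (inr true).
Proof. by rewrite /spread eqxx. Qed.

Lemma spread_lk y a : a \in lk e v ->
  spread y a = Num.max 0 (y (inr false) - load (y \o inl) a).
Proof.
move=> av; rewrite /spread av; case: eqP => // av'.
by rewrite av' inE e_irr in av.
Qed.

Lemma spread_outside y b : b \in B ->
  spread y b = Num.max 0 (y (inl b) - y (inr false)).
Proof.
move=> bB.
by rewrite /spread (negPf (outside_neq bB)) (negPf (outside_notin_lk bB)).
Qed.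

Lemma spread_ge0 y u : (forall q, 0 <= y q) -> 0 <= spread y u.
Proof.
by move=> y_ge0; rewrite /spread; do 2?case: ifP => _; rewrite ?le_max ?lexx.
Qed.

Lemma spread_continuous (T : topologicalType) (y : T -> V + bool -> R) u :
  (forall q, continuous (y^~ q)) -> continuous (fun t => spread (y t) u).
Proof.
move=> y_cont; rewrite /spread; case: (u == v); last case: (u \in lk e v).
- exact: y_cont.
- apply: subtract_continuous; first exact: y_cont.
  by apply: load_continuous => b; exact: y_cont.
- by apply: subtract_continuous; exact: y_cont.
Qed.

Lemma suspension_load0 y : (forall q, 0 <= y q) ->
  support y \in suspension (complexK e v) ->
  exists2 a, a \in lk e v & forall b, b \in B -> e a b -> y (inl b) = 0.
Proof.
move=> y_ge0; rewrite in_suspension => /andP[/complexKP[_ _ [a av aN]] _].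
exists a => // b bB ab; apply/eqP; apply: contraLR ab => yb.
by apply: aN; rewrite !inE.
Qed.

Lemma suspension_outside y b : (forall q, 0 <= y q) ->
  support y \in suspension (complexK e v) -> 0 < y (inl b) -> b \in B.
Proof.
move=> y_ge0; rewrite in_suspension => /andP[/complexKP[/fintype.subsetP sB _ _] _] yb.
by apply: sB; rewrite inE support_gt0.
Qed.

Lemma suspension_poles y : (forall q, 0 <= y q) ->
  support y \in suspension (complexK e v) -> 0 < y (inr true) -> y (inr false) = 0.
Proof.
move=> y_ge0; rewrite in_suspension => /andP[_ +] yt.
by rewrite -negb_and !support_gt0// yt/= -leNgt => yf; apply/eqP; rewrite eq_le yf y_ge0.
Qed.

(** If the pole inr false has weight, a neighbour of v with no load receives all of
    it; otherwise nothing is truncated. *)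
Lemma spread_gt0 y : (forall q, 0 <= y q) ->
  support y \in suspension (complexK e v) -> (exists q, 0 < y q) ->
  exists u, 0 < spread y u.
Proof.
move=> y_ge0 yK [q yq].
have [yf|yf] := ltP 0 (y (inr false)).
  have [a av ya] := suspension_load0 y_ge0 yK.
  by exists a; rewrite spread_lk// subtract_gt0 load_eq0.
case: q yq => [b|[]] yq.
- exists b; have bB := suspension_outside y_ge0 yK yq.
  by rewrite spread_outside// subtract_gt0 (le_lt_trans yf).
- by exists v; rewrite spread_v.
- by rewrite ltNge yf in yq.
Qed.

Lemma spread_support y : (forall q, 0 <= y q) ->
  support y \in suspension (complexK e v) -> independent e (support (spread y)).
Proof.
move=> y_ge0 yK.
have s_ge0 u : 0 <= spread y u by exact: spread_ge0.
apply: (@admissible_independent (y \o inl) (y (inr false))).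
  move: (yK); rewrite in_suspension => /andP[/complexKP[_ y_ind _] _].
  apply: independentS y_ind; apply/fintype.subsetP => b.
  by rewrite !inE => /andP[_ yb]; rewrite gt_eqF// (le_lt_trans _ yb).
move=> u; rewrite support_gt0//; case: (vertex_cases u) => [->|uv|uB].
- by rewrite spread_v => yt; constructor 1; rewrite (suspension_poles y_ge0 yK).
- rewrite spread_lk// subtract_gt0 => yu; constructor 2; split=> //.
    by rewrite (le_lt_trans _ yu)// load_ge0 => // b /=.
  move=> b bB ub; rewrite (le_trans _ (ltW yu))//.
  by apply: (@le_load (y \o inl)) => // b' /=.
- by rewrite spread_outside// subtract_gt0 => yu; constructor 3.
Qed.

Lemma trim_ge0 x u : (forall u, 0 <= x u) -> 0 <= trim x u.
Proof. by move=> x_ge0; rewrite /trim; case: ifP; rewrite // le_max lexx. Qed.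

Lemma trim_gt0_coord x u : (forall u, 0 <= x u) -> 0 < trim x u -> 0 < x u.
Proof.
move=> x_ge0; rewrite /trim; case: ifP => // _.
by rewrite subtract_gt0; apply: le_lt_trans; exact: lk_mass_ge0.
Qed.

(** Truncation can remove outer mass only when lk(v) carries some, which stays. *)
Lemma trim_gt0 x : (forall u, 0 <= x u) -> (exists u, 0 < x u) ->
  exists u, 0 < trim x u.
Proof.
move=> x_ge0 [u xu]; have [s_gt0|s_le0] := ltP 0 (lk_mass x).
  have [a av xa] := lk_mass_gt0 x_ge0 s_gt0; exists a.
  by rewrite /trim finset.in_setC in_st av orbT.
exists u; rewrite /trim; case: ifP => // _.
by rewrite subtract_gt0 (le_lt_trans s_le0).
Qed.

Lemma trim_continuous (T : topologicalType) (x : T -> V -> R) u :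
  (forall u, continuous (x^~ u)) -> continuous (fun t => trim (x t) u).
Proof.
move=> x_cont; rewrite /trim; case: (u \in B); last exact: x_cont.
by apply: subtract_continuous => //; exact: lk_mass_continuous.
Qed.

(** Together with spread_collapse_admissible, this puts the supports of the trimmed
    point and of the image under the composite in one independent set. *)
Lemma trim_admissible x u : (forall u, 0 <= x u) -> independent e (support x) ->
  0 < trim x u -> admissible x (lk_mass x) u.
Proof.
move=> x_ge0 x_ind tu; have xu := trim_gt0_coord x_ge0 tu.
case: (vertex_cases u) => [uv|uv|uB].
- constructor 1; split=> //; apply/eqP; rewrite eq_le lk_mass_ge0// andbT leNgt.
  apply/negP => /(lk_mass_gt0_vanish x_ge0 x_ind)[xv _].
  by rewrite uv xv ltxx in xu.
- constructor 2; split=> //; first exact: lt_le_trans xu (le_lk_mass _ uv).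
  move=> b bB ub; suff -> : x b = 0 by exact: lk_mass_ge0.
  apply/eqP; rewrite eq_le x_ge0 andbT leNgt; apply/negP => xb.
  have /independentP/(_ u b) := x_ind.
  by rewrite !support_gt0// xu xb ub => /(_ isT isT).
- by constructor 3; move: tu; rewrite /trim uB subtract_gt0.
Qed.

(** The minimal load can only raise the level that an outer coordinate must exceed
    in order to survive both maps.  When lk(v) carries mass it vanishes, so
    collapse then leaves the outer coordinates as they were up to scale, and
    load comparisons after collapse hold for x itself. *)
Lemma spread_collapse_admissible x y (c : R) u :
  (forall u, 0 <= x u) -> independent e (support x) -> 0 < c ->
  (forall q, y q = c * collapse x q) ->
  0 < spread y u -> admissible x (lk_mass x) u.
Proof.
move=> x_ge0 x_ind c_gt0 yE; case: (vertex_cases u) => [->|uv|uB].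
- rewrite spread_v yE pmulr_rgt0//= => xv; constructor 1; split=> //.
  apply/eqP; rewrite eq_le lk_mass_ge0// andbT leNgt; apply/negP.
  move=> /(lk_mass_gt0_vanish x_ge0 x_ind)[xv0 m0].
  move: xv; rewrite xv0 m0 add0r big1 ?ltxx// => b _.
  exact/min_idPr.
- rewrite spread_lk// subtract_gt0 => yu; constructor 2.
  have y_ge0 q : 0 <= y q by rewrite yE pmulr_rge0// collapse_ge0.
  have s_gt0 : 0 < lk_mass x.
    have := le_lt_trans (load_ge0 u (fun b => y_ge0 (inl b))) yu.
    by rewrite yE pmulr_rgt0.
  split=> // b bB ub.
  have := le_lt_trans (le_load (fun b => y_ge0 (inl b)) bB ub) yu.
  have [_ m0] := lk_mass_gt0_vanish x_ge0 x_ind s_gt0.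
  rewrite !yE ltr_pM2l//= bB m0 subr0 => xb.
  by apply/ltW; apply: le_lt_trans xb; rewrite le_max lexx orbT.
- rewrite spread_outside// subtract_gt0 !yE ltr_pM2l//= uB lt_max => /orP[s0|xs].
    by rewrite ltNge lk_mass_ge0 in s0.
  by constructor 3; split=> //; apply: lt_le_trans xs _; rewrite gerBl min_load_ge0.
Qed.

(** A neighbour of v without load in y has none after spreading either, so the
    minimal load is 0 and collapse creates no mass at the pole inr true. *)
Lemma collapse_spread_support x y (c : R) q :
  (forall q, 0 <= y q) -> support y \in suspension (complexK e v) -> 0 < c ->
  (forall u, x u = c * spread y u) ->
  0 < collapse x q -> 0 < y q.
Proof.
move=> y_ge0 yK c_gt0 xE.
have x_ge0 u : 0 <= x u by rewrite xE pmulr_rge0// spread_ge0.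
have x_b b : b \in B -> 0 < x b -> 0 < y (inl b).
  move=> bB; rewrite xE pmulr_rgt0// spread_outside// subtract_gt0.
  exact: le_lt_trans.
have m0 : min_load x = 0.
  have [a av ya] := suspension_load0 y_ge0 yK.
  apply/eqP; rewrite eq_le min_load_ge0// andbT.
  rewrite (le_trans (min_load_le x av))// load_eq0// => b bB ab.
  apply/eqP; rewrite eq_le x_ge0 andbT leNgt; apply/negP => /(x_b b bB).
  by rewrite ya ?ltxx.
case: q => [b|[]] /=.
- case: ifP => bB; last by rewrite ltxx.
  by rewrite subtract_gt0 m0; exact: x_b.
- rewrite m0 big1; last by move=> b _; exact/min_idPr.
  by rewrite addr0 xE pmulr_rgt0// spread_v.
- move=> /(lk_mass_gt0 x_ge0)[a av]; rewrite xE pmulr_rgt0// spread_lk//.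
  by rewrite subtract_gt0; apply: le_lt_trans; apply: load_ge0 => b /=.
Qed.

End Maps.

(** * The homotopy equivalence *)

Theorem theorem6p4 (R : realType) (V : finType) (e : rel V)
    (e_sym : symmetric e) (e_irr : irreflexive e)
    (v : V) (n : nat) (hn : (1 <= n)%N) (deg_v : degree e v = n)
    (lk_indep : independent e (lk e v)) :
  homotopy_equivalent R (realization R (independence_complex e))
    (realization R (suspension (complexK e v))).
Proof.
have deg_gt0 : (0 < degree e v)%N by rewrite deg_v.
have /card_gt0P[a0 a0_lk] := deg_gt0.
set I := independence_complex e; set S := suspension (complexK e v).
have in_I s : (s \in I) = independent e s by exact: in_independence_complex.
have I_complex : is_complex I by exact: induced_independence_is_complex.
have S_complex : is_complex S.
  exact: join_is_complex (complexK_is_complex deg_gt0) S0_is_complex.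
have I_ind (x : realization R I) : independent e (support (coord x)).
  by rewrite -in_I; exact: coord_support.
have [f [f_cont fE]] : exists f : realization R I -> realization R S,
    continuous f /\ forall x, exists2 c, 0 < c &
      forall q, coord (f x) q = c * collapse e v a0 (coord x) q.
  apply: normalized_map.
  - by move=> q; apply: collapse_continuous; exact: coord_continuous.
  - by move=> x q; apply: collapse_ge0 => //; exact: coord_ge0.
  - move=> x; apply: collapse_gt0 (coord_gt0 x) => //; exact: coord_ge0.
  - by move=> x; apply: collapse_support => //; exact: coord_ge0.
have [g [g_cont gE]] : exists g : realization R S -> realization R I,
    continuous g /\ forall y, exists2 c, 0 < c &
      forall u, coord (g y) u = c * spread e v (coord y) u.
  apply: normalized_map.
  - by move=> u; apply: spread_continuous; exact: coord_continuous.
  - by move=> y u; exact/spread_ge0/coord_ge0.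
  - move=> y; apply: spread_gt0 (coord_gt0 y) => //; [exact: coord_ge0|].
    exact: coord_support.
  - move=> y; rewrite in_I; apply: spread_support => //.
      exact: coord_ge0.
    exact: coord_support.
have [h [h_cont hE]] : exists h : realization R I -> realization R I,
    continuous h /\ forall x, exists2 c, 0 < c &
      forall u, coord (h x) u = c * trim e v (coord x) u.
  apply: normalized_map.
  - by move=> u; apply: trim_continuous; exact: coord_continuous.
  - by move=> x u; exact/trim_ge0/coord_ge0.
  - by move=> x; apply: trim_gt0 (coord_gt0 x); exact: coord_ge0.
  - move=> x; rewrite in_I; apply: independentS (I_ind x).
    apply/fintype.subsetP => u; rewrite !support_gt0.
    + exact/trim_gt0_coord/coord_ge0.
    + exact: coord_ge0.
    + by move=> u'; exact/trim_ge0/coord_ge0.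
have h_trim x u : u \in support (coord (h x)) -> 0 < trim e v (coord x) u.
  rewrite support_gt0; last exact: coord_ge0.
  by have [c c_gt0 ->] := hE x; rewrite pmulr_rgt0.
exists f, g; split=> //.
- apply: (@homotopic_broken_line R V _ I (g \o f) h id) => //.
  + by move=> x; apply: continuous_comp; [exact: f_cont|exact: g_cont].
  + by move=> x; exact: cvg_id.
  + move=> x; rewrite in_I.
    apply: (@admissible_independent R V e v e_sym e_irr lk_indep (coord x)
      (lk_mass e v (coord x))).
      apply: independentS (I_ind x); apply/fintype.subsetP => u.
      rewrite inE support_gt0; last exact: coord_ge0.
      by move=> /andP[_]; apply: le_lt_trans; exact/lk_mass_ge0/coord_ge0.
    move=> u; rewrite finset.in_setU => /orP[|/h_trim]; last first.
      exact: (trim_admissible e_sym a0_lk (coord_ge0 x) (I_ind x)).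
    rewrite support_gt0; last exact: coord_ge0.
    have [c c_gt0 ->] := gE (f x); rewrite pmulr_rgt0// => su.
    have [d d_gt0 dE] := fE x.
    exact: (spread_collapse_admissible e_sym e_irr a0_lk (coord_ge0 x) (I_ind x)
      d_gt0 dE su).
  + move=> x; rewrite in_I; apply: independentS (I_ind x).
    apply/fintype.subsetP => u; rewrite finset.in_setU => /orP[/h_trim|//].
    by rewrite support_gt0; [apply: trim_gt0_coord|]; exact: coord_ge0.
- apply: (@homotopic_broken_line R _ _ S (f \o g) id id) => //.
  + by move=> y; apply: continuous_comp; [exact: g_cont|exact: f_cont].
  + by move=> y; exact: cvg_id.
  + by move=> y; exact: cvg_id.
  + move=> y; have [_ S_sub] := S_complex; apply: S_sub (coord_support y).
    rewrite finset.subUset fintype.subxx andbT; apply/fintype.subsetP => q.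
    rewrite !support_gt0; try exact: coord_ge0.
    have [c c_gt0 ->] := fE (g y); rewrite pmulr_rgt0//.
    have [d d_gt0 dE] := gE y.
    apply: (collapse_spread_support e_irr a0_lk) d_gt0 dE; first exact: coord_ge0.
    exact: coord_support.
  + by move=> y; rewrite finset.setUid coord_support.
Qed.
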